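(* For every multi-index $\mathbf{k}$ and every integer $r\ge 0$, there exist unique integers $C_{\mathbf{k},\boldsymbol\ell}$ (indexed by the lowering multi-indices $\boldsymbol\ell$ with $|\boldsymbol\ell|=r$, and subject to the convention that $C_{\mathbf{k},\boldsymbol\ell}:=0$ whenever $\mathbf{k}-\boldsymbol\ell+\overleftarrow{\boldsymbol\ell}$ has a negative component) such that $$\bar\partial^{\,r}\mathbf{x}^{\mathbf{k}}=\sum_{|\boldsymbol\ell|=r}C_{\mathbf{k},\boldsymbol\ell}\,\mathbf{x}^{\mathbf{k}-\boldsymbol\ell+\overleftarrow{\boldsymbol\ell}},$$ the sum being over lowering multi-indices $\boldsymbol\ell$. These coefficients satisfy $C_{\mathbf{k},\mathbf{0}}=1$ and $$C_{\mathbf{k},\boldsymbol\ell}=\sum_{a\in A}\sum_{\substack{j\ge 0\\ \ell_j^a\ge 1}}C_{\mathbf{k},\boldsymbol\ell-\mathbf{e}_j^a}\,\big(k_j^a-\ell_j^a+1+\ell_{j+1}^a\big)$$ for every nonzero lowering multi-index $\boldsymbol\ell$.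
   Context: $A$ is a finite set, $\mathbb{K}$ is a field of characteristic zero, and $I_A:=A\times\mathbb{Z}_{\ge -1}$. A multi-index is a finitely supported map $\mathbf{k}:I_A\to\mathbb{Z}_{\ge 0}$, written $k_j^a:=\mathbf{k}(a,j)$; $|\mathbf{k}|=\sum_{a\in A,\,j\ge -1}k_j^a$. $\mathbf{e}_j^a$ is the multi-index with $(a,j)$-coordinate $1$ and all others $0$; sums and differences are componentwise. $N(A)$ is the polynomial algebra over $\mathbb{K}$ in the variables $x_j^a$ ($a\in A$, $j\ge -1$), and $\mathbf{x}^{\mathbf{k}}:=\prod_{a,j}(x_j^a)^{k_j^a}$. $\bar\partial:N(A)\to N(A)$ is the ($\mathbb{K}$-linear) derivation with $\bar\partial(x_j^a)=x_{j-1}^a$ for $j\ge 0$ and $\bar\partial(x_{-1}^a)=0$. A lowering multi-index is a multi-index $\boldsymbol\ell$ on $I_A$ with $\ell_{-1}^a=0$ for all $a\in A$; its left shift $\overleftarrow{\boldsymbol\ell}$ is the multi-index with $(\overleftarrow{\boldsymbol\ell})_j^a:=\ell_{j+1}^a$ for $a\in A$, $j\ge -1$. Whenever an exponent has a negative component, the corresponding monomial is understood to be zero. *)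

(* Defs.v *)
From HB Require Import structures.
From mathcomp Require Import all_boot all_order all_algebra finmap.
From mathcomp Require Import boolp classical_sets functions cardinality fsbigop.
From mathcomp.multinomials Require Import monalg.
From mathcomp Require Import zify.

Set Implicit Arguments.
Unset Strict Implicit.
Unset Printing Implicit Defensive.
Import Order.TTheory GRing.Theory Num.Theory.

Local Open Scope classical_set_scope.
Local Open Scope ring_scope.

Definition level := {j : int | -1 <= j}.

Definition level_bot : level := Sub (-1) (lexx _).

Lemma level_up_subproof (j : level) : -1 <= val j + 1.
Proof. by rewrite (le_trans (valP j)) // lerDl. Qed.

Definition level_up (j : level) : level := Sub (val j + 1) (level_up_subproof j).

(* j - 1, or None for j = -1 *)
Definition level_down (j : level) : option level := insub (val j - 1).

Lemma level_up_down (j i : level) : (level_down j == Some i) = (j == level_up i).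
Proof.
rewrite /level_down -val_eqE /=; case: insubP => [u _ Eu|].
  rewrite -[LHS]/(u == i) -val_eqE /= Eu; exact: subr_eq.
move=> nle; apply/esym/negbTE; apply: contra nle => /eqP ->.
by rewrite addrK (valP i).
Qed.

Lemma level_down_up (j : level) : level_down (level_up j) = Some j.
Proof. by apply/eqP; rewrite level_up_down. Qed.

Lemma level_down_bot : level_down level_bot = None.
Proof. by rewrite /level_down insubF. Qed.

Lemma level_downP (j : level) :
  (j = level_bot /\ level_down j = None) \/
  (exists2 i, j = level_up i & level_down j = Some i).
Proof.
case E: (level_down j) => [i|]; first by right; exists i => //;
  apply/eqP; rewrite -level_up_down E.
left; split=> //; apply: val_inj => /=; apply: le_anti; rewrite (valP j) andbT.
move: E; rewrite /level_down; case: insubP => // + _.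
rewrite -ltNge -[sval j]/(val j); move: (val j) => n; lia.
Qed.

Definition var_index (A : finType) := (A * level)%type.

(* The library writes these multiplicatively: the sum, truncated
   difference, zero and unit vector e_i are mulcm, divcm, mone and ucm i, and
   |k| is mdeg k. *)
Definition multiindex (A : finType) := {cmonom (var_index A)}.

Lemma scale_mulAC (K : fieldType) (R : comAlgType K) (c : K) (u v w : R) :
  c *: (u * v) * w = c *: (u * w * v).
Proof. by rewrite -scalerAl mulrAC. Qed.

Lemma leibniz_sum (R : nzRingType) (D : {additive R -> R}) (I : Type)
    (s : seq I) (F : I -> R) (q : R) :
  (forall i, D (F i * q) = D (F i) * q + F i * D q) ->
  D ((\sum_(i <- s) F i) * q) =
    D (\sum_(i <- s) F i) * q + (\sum_(i <- s) F i) * D q.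
Proof.
by move=> h; rewrite raddf_sum !mulr_suml raddf_sum -big_split; exact: eq_bigr.
Qed.

Lemma leibniz_scale (K : fieldType) (R : comAlgType K) (D : {linear R -> R})
    (c d : K) (u v : R) :
  D (u * v) = D u * v + u * D v ->
  D (c *: u * (d *: v)) = D (c *: u) * (d *: v) + c *: u * D (d *: v).
Proof.
move=> h; rewrite -scalerAl -scalerAr !linearZ /= h !scalerDr.
by rewrite -!scalerAl -!scalerAr.
Qed.

Section PolynomialAlgebra.
Variables (K : fieldType) (A : finType).

Definition polyalg := {malg K[multiindex A]}.

Definition var (i : var_index A) : polyalg := << ucm i >>.

Definition monomial (k : multiindex A) : polyalg :=
  \prod_(i <- finsupp k) var i ^+ k i.

Definition dbar_var (i : var_index A) : polyalg :=
  if level_down i.2 is Some j then var (i.1, j) else 0.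

Definition dbar_basis (m : multiindex A) : polyalg :=
  \sum_(i <- finsupp m) (m i)%:R *: (<< divcm m (ucm i) >> * dbar_var i).

(* The derivation with dbar (var i) = dbar_var i; it is characterised by
   dbar_linear, dbarM, dbar_var_up and dbar_var_bot below. *)
Definition dbar (p : polyalg) : polyalg :=
  \sum_(m <- msupp p) p@_m *: dbar_basis m.

Lemma basisM (m1 m2 : multiindex A) :
  << mulcm m1 m2 >> = << m1 >> * << m2 >> :> polyalg.
Proof. by rewrite malgM_def fgmulUU mulr1. Qed.

Lemma monomialE (k : multiindex A) : monomial k = << k >>.
Proof.
pose P (m : multiindex A) : polyalg := << m >>.
pose pw i n : multiindex A := iter n (mulcm (ucm i)) mone.
have PM m1 m2 : P (mulcm m1 m2) = P m1 * P m2 by exact: basisM.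
have PX i n : P (pw i n) = var i ^+ n.
  elim: n => [|n IH]; first by rewrite expr0.
  by rewrite exprS -IH -PM.
have pwE i n j : pw i n j = ((i == j) * n)%N.
  elim: n => [|n IH]; first by rewrite /pw /= onecmE muln0.
  by rewrite /pw iterS mulcmE -/(pw i n) IH ucmE mulnS.
have key (s : seq (var_index A)) : uniq s ->
    P (foldr (fun i m => mulcm (pw i (k i)) m) mone s)
      = \prod_(i <- s) var i ^+ k i /\
    forall j, foldr (fun i m => mulcm (pw i (k i)) m) (mone : multiindex A) s j
      = ((j \in s) * k j)%N.
  elim: s => [|i s IH] /=; first by rewrite big_nil; split=> // j; rewrite onecmE.
  case/andP=> nis /IH [IH1 IH2]; split.
    by rewrite PM PX IH1 big_cons.
  move=> j; rewrite mulcmE IH2 pwE inE eq_sym.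
  by case: eqVneq => [->|_]; rewrite ?(negbTE nis) /= ?addn0.
have [e1 e2] := key _ (fset_uniq (finsupp k)).
rewrite /monomial -e1 /P; congr (<< _ >>); apply/eqP/cmP => j.
by rewrite e2; case: finsuppP => // _; rewrite mul1n.
Qed.

Lemma dbarEw (D : {fset multiindex A}) (p : polyalg) :
  (msupp p `<=` D)%fset -> dbar p = \sum_(m <- D) p@_m *: dbar_basis m.
Proof.
move=> le; rewrite [LHS](big_fset_incl _ le) => //= m _ /mcoeff_outdom ->.
by rewrite scale0r.
Qed.

Lemma dbar_linear (c : K) (p q : polyalg) :
  dbar (c *: p + q) = c *: dbar p + dbar q.
Proof.
pose D := (msupp (c *: p + q) `|` (msupp p `|` msupp q))%fset.
have lep : (msupp p `<=` D)%fset by rewrite /D fsubsetU // fsubsetUl orbT.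
have leq : (msupp q `<=` D)%fset by rewrite /D fsubsetU // fsubsetUr orbT.
rewrite (dbarEw lep) (dbarEw leq) (@dbarEw D) ?fsubsetUl //.
rewrite scaler_sumr -big_split /=; apply: eq_bigr => m _.
by rewrite mcoeffD mcoeffZ scalerDl scalerA.
Qed.

HB.instance Definition _ :=
  GRing.isLinear.Build K polyalg polyalg *:%R dbar dbar_linear.

Lemma dbar_basisE (m : multiindex A) : dbar << m >> = dbar_basis m.
Proof. by rewrite (dbarEw msuppU_le) big_seq_fset1 mcoeffUU scale1r. Qed.

Lemma dbar_basisEw (D : {fset var_index A}) (m : multiindex A) :
  (finsupp m `<=` D)%fset ->
  dbar_basis m =
    \sum_(i <- D) (m i)%:R *: (<< divcm m (ucm i) >> * dbar_var i).
Proof.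
move=> le; rewrite [LHS](big_fset_incl _ le) => //= i _ mi.
by rewrite (fsfun_dflt mi) scale0r.
Qed.

Lemma dbar_basisM (m1 m2 : multiindex A) :
  dbar_basis (mulcm m1 m2) =
    dbar_basis m1 * << m2 >> + << m1 >> * dbar_basis m2.
Proof.
pose D := (finsupp (mulcm m1 m2) `|` (finsupp m1 `|` finsupp m2))%fset.
have le1 : (finsupp m1 `<=` D)%fset by rewrite /D fsubsetU // fsubsetUl orbT.
have le2 : (finsupp m2 `<=` D)%fset by rewrite /D fsubsetU // fsubsetUr orbT.
rewrite (dbar_basisEw le1) (dbar_basisEw le2) (@dbar_basisEw D) ?fsubsetUl //.
transitivity (\sum_(i <- D)
    ((m1 i)%:R *: (<< divcm m1 (ucm i) >> * dbar_var i) * << m2 >> +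
     << m1 >> * ((m2 i)%:R *: (<< divcm m2 (ucm i) >> * dbar_var i)))); last first.
  rewrite big_split /=; congr (_ + _).
    by rewrite mulr_suml.
  by rewrite [RHS]mulr_sumr.
apply: eq_bigr => i _.
have aux (n1 n2 : multiindex A) :
    (n1 i)%:R *: (<< divcm n1 (ucm i) >> * dbar_var i) * << n2 >> =
    (n1 i)%:R *: (<< divcm (mulcm n1 n2) (ucm i) >> * dbar_var i).
  have [->|n1i] := posnP (n1 i); first by rewrite [X in X * _]scale0r [RHS]scale0r [LHS]mul0r.
  rewrite scale_mulAC.
  have <- : mulcm (divcm n1 (ucm i)) n2 = divcm (mulcm n1 n2) (ucm i).
    2: by rewrite basisM.
  apply/eqP/cmP => j; rewrite !(mulcmE, divcmE) ucmE.
  by case: eqVneq => [<-|_]; rewrite ?subn0 // addnBAC.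
rewrite aux [X in _ + X]mulrC aux mulcmE natrD [LHS]scalerDl.
by rewrite [mulcm m2 m1]mulcmC.
Qed.

Lemma dbarM (p q : polyalg) : dbar (p * q) = dbar p * q + p * dbar q.
Proof.
have basisZ (c : K) (l : multiindex A) : << c *g l >> = c *: << l >> :> polyalg.
  apply: (proj1 (malgP _ _)) => j.
  rewrite [RHS]mcoeffZ.
  rewrite [LHS]mcoeffU.
  rewrite [X in _ * X]mcoeffU.
  by rewrite mulrnAr mulr1.
rewrite (monalgE p); apply: leibniz_sum => m.
rewrite [LHS](congr1 (@dbar) (mulrC _ _)) [RHS]addrC.
rewrite [X in X + _]mulrC [X in _ + X]mulrC.
rewrite (monalgE q); apply: leibniz_sum => n.
rewrite (basisZ p@_m m) (basisZ q@_n n).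
apply: leibniz_scale.
apply: etrans (congr1 dbar (esym (basisM n m))) _.
rewrite [LHS]dbar_basisE [LHS]dbar_basisM.
pose leib (a b : polyalg) := a * << m >> + << n >> * b.
exact (f_equal2 leib (esym (dbar_basisE n)) (esym (dbar_basisE m))).
Qed.

Lemma dbar_varE (i : var_index A) : dbar (var i) = dbar_var i.
Proof.
rewrite /var dbar_basisE (@dbar_basisEw [fset i]%fset).
  rewrite big_seq_fset1 ucmE eqxx scale1r.
  have -> : divcm (ucm i) (ucm i) = mone :> multiindex A.
    by apply/eqP/cmP => j; rewrite divcmE subnn onecmE.
  by rewrite mul1r.
by apply/fsubsetP => j; rewrite mem_finsupp ucmE in_fset1; case: (eqVneq i j).
Qed.

Lemma dbar_var_up (a : A) (j : level) : dbar (var (a, level_up j)) = var (a, j).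
Proof. by rewrite dbar_varE /dbar_var level_down_up. Qed.

Lemma dbar_var_bot (a : A) : dbar (var (a, level_bot)) = 0.
Proof. by rewrite dbar_varE /dbar_var level_down_bot. Qed.

End PolynomialAlgebra.

Section LoweringIndices.
Variable A : finType.

Definition is_lowering (l : multiindex A) : Prop :=
  forall a : A, l (a, level_bot) = 0%N.

Definition lowering_of_size (r : nat) : set (multiindex A) :=
  [set l | is_lowering l /\ mdeg l = r].

Definition left_shift (l : multiindex A) : multiindex A :=
  [cmonom l (i.1, level_up i.2)
    | i in seq_fset tt
        (pmap (fun i => omap (pair i.1) (level_down i.2)) (finsupp l))]%M.

Lemma left_shiftE (l : multiindex A) (a : A) (j : level) :
  left_shift l (a, j) = l (a, level_up j).
Proof.
rewrite /left_shift cmE fsfun_fun seq_fsetE mem_pmap.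
case: ifP => //= /negbT/negP h.
case: finsuppP => // hl; case: h; apply/mapP; exists (a, level_up j) => //=.
by rewrite level_down_up.
Qed.

Definition exponent := {fsfun var_index A -> int with 0}.

Definition negative_exponent (z : exponent) : bool :=
  has (fun i => z i < 0) (finsupp z).

Lemma negative_exponentP (z : exponent) :
  reflect (exists i, z i < 0) (negative_exponent z).
Proof.
apply: (iffP hasP) => [[i _ zi]|[i zi]]; exists i => //.
by rewrite mem_finsupp lt_eqF.
Qed.

Definition lowered (k l : multiindex A) : exponent :=
  [fsfun i in (finsupp k `|` (finsupp l `|` finsupp (left_shift l)))%fset
    => (k i)%:Z - (l i)%:Z + (left_shift l i)%:Z | 0].

Lemma loweredE (k l : multiindex A) (i : var_index A) :
  lowered k l i = (k i)%:Z - (l i)%:Z + (left_shift l i)%:Z.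
Proof.
rewrite /lowered fsfun_fun !in_fsetU.
by case: finsuppP => // _; case: finsuppP => //= _; case: finsuppP.
Qed.

End LoweringIndices.

Section Coefficients.
Variables (K : fieldType) (A : finType).

Definition zmonomial (z : exponent A) : polyalg K A :=
  if negative_exponent z then 0 else \prod_(i <- finsupp z) var K i ^+ `|z i|%N.

(* C restricted to the lowering multi-indices of size r is a family of expansion
   coefficients for dbar^r x^k; other values of C are irrelevant.  The sum has
   finite support by finite_lowered, so the junk value 0 of
   an infinitely supported sum never arises. *)
Definition expansion_coefficients
    (k : multiindex A) (r : nat) (C : multiindex A -> int) : Prop :=
  (forall l, lowering_of_size r l -> negative_exponent (lowered k l) -> C l = 0)
  /\ iter r (@dbar K A) (monomial K k) =
     \sum_(l \in lowering_of_size r) (C l)%:~R *: zmonomial (lowered k l).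

End Coefficients.

Lemma finite_lowered (A : finType) (k : multiindex A) (r : nat) :
  finite_set
    [set l | lowering_of_size r l /\ ~~ negative_exponent (lowered k l)].
Proof.
pose N := (\sum_(i <- finsupp k) absz (val i.2))%N.
pose lev (n : nat) : level := insubd level_bot (n%:Z - 1).
pose E : finType := {ffun A * 'I_(N.+2) -> 'I_r.+1}.
pose dec (f : E) : multiindex A :=
  [cmonom (f (i.1, inord (absz (val i.2 + 1)%R)) : nat)
    | i in seq_fset tt [seq (u.1, lev u.2) | u : A * 'I_(N.+2)]]%M.
apply: (@sub_finite_set _ _ (dec @` [set: E])); last first.
  exact/finite_image/finite_finset.
move=> l [[lowl sizel] /negative_exponentP negl] /=.
have nonneg i : (l i <= k i + left_shift l i)%N.
  rewrite leqNgt; apply/negP => lt; apply: negl; exists i.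
  by rewrite loweredE addrAC subr_lt0 -PoszD ltz_nat.
have kN a j : (a, j) \in finsupp k -> (absz (val j) <= N)%N.
  by move=> h; rewrite /N (big_fsetD1 _ h) /= leq_addr.
have small a (j : level) : N%:Z < val j -> l (a, j) = 0%N.
  move=> Nj; apply/eqP; rewrite -leqn0 -ltnS ltnNge; apply/negP => pos.
  have grow n : exists2 i : level, val i = val j + n%:Z & (0 < l (a, i))%N.
    elim: n => [|n [i Ei pi]]; first by exists j; rewrite ?addr0.
    exists (level_up i); first by rewrite /= Ei -addrA -PoszD addn1.
    have := leq_trans pi (nonneg (a, i)); rewrite left_shiftE.
    suff -> : k (a, i) = 0%N by rewrite add0n.
    apply: contraTeq (Nj); rewrite -lt0n lt0n -mem_finsupp => /kN h.
    rewrite -leNgt; apply: le_trans (_ : val i <= _); first by rewrite Ei lerDl.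
    by apply: le_trans (ler_norm _) _; rewrite -abszE lez_nat.
  have [n nP] : exists n, forall i : level,
      (a, i) \in finsupp l -> (absz (val i) <= n)%N.
    exists (\sum_(i <- finsupp l) (absz (val i.2)))%N => i h.
    by rewrite (big_fsetD1 _ h) /= leq_addr.
  have [i Ei] := grow n.+1; rewrite lt0n -mem_finsupp => /nP.
  have j0 : 0 < val j by exact: le_lt_trans Nj.
  rewrite -lez_nat abszE ger0_norm Ei; last by rewrite addr_ge0 // ltW.
  rewrite leNgt => /negP; apply; rewrite -addn1 PoszD addrA.
  lia.
have ler a (j : level) : (l (a, j) <= r)%N.
  rewrite -sizel /mdeg; case: finsuppP => // h.
  by rewrite (big_fsetD1 _ h) /= leq_addr.
pose f : E := [ffun u : A * 'I_(N.+2) => inord (l (u.1, lev u.2))].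
exists f => //; apply/eqP/cmP => -[a j]; rewrite cmE fsfun_fun seq_fsetE /=.
have jge : -1 <= val j by exact: (valP j).
have levK : lev (absz (val j + 1)) = j.
  apply: val_inj; rewrite /lev val_insubd gez0_abs; last by lia.
  by rewrite addrK jge.
case: ifP => [/mapP[[b n] _ [Eb En]]|/negbT nD].
  have nE : absz (val j + 1) = n.
    rewrite En /lev val_insubd ifT; last by lia.
    by rewrite subrK.
  by rewrite nE inord_val /f ffunE /= -nE levK inordK // ltnS.
have [jN|Nj] := leP (val j) N%:Z; last by rewrite small.
case/negP: nD; apply/mapP.
have lt : leq (absz (val j + 1)).+1 N.+2 by lia.
exists (a, Ordinal lt); rewrite ?mem_enum //=; congr (_, _); exact/esym.
Qed.

(* Main.v *)
(* Applying dbar to x^(k - l + shift l) gives the sum, over the variables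
   (a, j) with j >= 0, of its exponent k_j - l_j + l_(j+1) at (a, j) times the
   monomial attached to l + e_(a, j).  Collecting terms by l' = l + e_(a, j)
   turns coefficients for dbar^r x^k into coefficients for dbar^(r+1) x^k, by
   the stated recursion; negative exponents never contribute, because leaving
   the nonnegative range multiplies by the exponent 0.  The coefficients are
   unique because l |-> k - l + shift l is injective on lowering indices
   (induct on the level from l_(-1) = 0) and K has characteristic zero. *)

Require Import Defs.
From HB Require Import structures.
From mathcomp Require Import all_boot all_order all_algebra finmap.
From mathcomp Require Import boolp classical_sets functions cardinality fsbigop.
From mathcomp.multinomials Require Import monalg.
From mathcomp Require Import zify ring.

Set Implicit Arguments.
Unset Strict Implicit.
Unset Printing Implicit Defensive.
Import Order.TTheory GRing.Theory Num.Theory.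

Local Open Scope classical_set_scope.
Local Open Scope ring_scope.

(** * Induction on levels and integers in characteristic zero *)

Lemma level_ind (P : level -> Prop) :
  P level_bot -> (forall j, P j -> P (level_up j)) -> forall j, P j.
Proof.
move=> Pbot Pup j.
have [n] : exists n : nat, val j = n%:Z - 1.
  by exists (absz (val j + 1)); have := valP j; lia.
elim: n j => [|n IH] j vj.
  by have -> : j = level_bot by apply: val_inj; rewrite vj.
have [[Ej _]|[i Ej _]] := level_downP j; first by rewrite Ej.
by rewrite Ej in vj *; apply/Pup/IH; move: vj => /=; lia.
Qed.

Lemma intr_inj_pchar0 (K : fieldType) :
  [pchar K] =i pred0 -> injective (intr : int -> K).
Proof.
move=> /pcharf0P charK0 c d /eqP; rewrite -subr_eq0 -rmorphB /= => cd0.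
apply/subr0_eq; move: (c - d) cd0 => [n|n].
  by rewrite -[_%:~R]/(n%:R) charK0 => /eqP ->.
by rewrite -[_%:~R]/(- n.+1%:R) oppr_eq0 charK0.
Qed.

(** * Exponents attached to lowering multi-indices, and uniqueness *)

Section Lowering.
Variable A : finType.
Implicit Types (k l : multiindex A) (i : var_index A).

(** The exponent at [(a, j)] together with [l (a, j)] determines [l (a, level_up j)]. *)
Lemma lowered_inj k l l' : is_lowering l -> is_lowering l' ->
  lowered k l =1 lowered k l' -> l = l'.
Proof.
move=> ll ll' eqz; apply/eqP/cmP => -[a j].
elim/level_ind: j => [|j IH]; first by rewrite ll ll'.
by have := eqz (a, j); rewrite !loweredE !left_shiftE IH => /addrI [].
Qed.

(** The truncated subtraction comes last, so that it is exact whenever [lowered k l] has no negative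
    component. *)
Definition lowered_nat k l : multiindex A := divcm (mulcm k (left_shift l)) l.

Lemma lowered_natE k l : ~~ negative_exponent (lowered k l) ->
  forall i, lowered k l i = (lowered_nat k l i)%:Z.
Proof.
move=> /negative_exponentP nneg i; rewrite divcmE mulcmE.
have : ~~ (lowered k l i < 0) by apply/negP => zi; apply: nneg; exists i.
by rewrite loweredE; lia.
Qed.

Lemma lowered_nat_inj k l l' : is_lowering l -> is_lowering l' ->
  ~~ negative_exponent (lowered k l) -> ~~ negative_exponent (lowered k l') ->
  lowered_nat k l = lowered_nat k l' -> l = l'.
Proof.
move=> ll ll' nl nl' eqm; apply: (@lowered_inj k) => // i.
by rewrite !lowered_natE // eqm.
Qed.

Lemma zmonomialE (K : fieldType) k l : ~~ negative_exponent (lowered k l) ->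
  zmonomial K (lowered k l) = << lowered_nat k l >>.
Proof.
move=> nl; rewrite /zmonomial (negbTE nl) -monomialE /monomial.
have -> : finsupp (lowered k l) = finsupp (lowered_nat k l).
  by apply/fsetP => i; rewrite !mem_finsupp lowered_natE.
by apply: eq_bigr => i _; rewrite lowered_natE.
Qed.

(** The indices that can contribute to an expansion. By [finite_lowered] this is not the default
    empty value that [fset_set] takes on infinite sets. *)
Definition nonneg_lowered k r : {fset multiindex A} :=
  fset_set [set l | lowering_of_size r l /\ ~~ negative_exponent (lowered k l)].

Lemma nonneg_loweredP k r l : l \in nonneg_lowered k r <->
  lowering_of_size r l /\ ~~ negative_exponent (lowered k l).
Proof. by rewrite in_fset_set ?inE //; exact: finite_lowered. Qed.

(** Replaces a possibly infinite index set by a finite one, so that linearity and exchange of sums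
    apply. *)
Lemma fsbig_lowering (V : nmodType) k r (f : multiindex A -> V) :
  (forall l, lowering_of_size r l -> negative_exponent (lowered k l) ->
    f l = 0) ->
  \sum_(l \in lowering_of_size r) f l = \sum_(l <- nonneg_lowered k r) f l.
Proof.
move=> f0; rewrite (fsbigE (nonneg_lowered k r)).
- rewrite big_seq_cond [RHS]big_seq; apply: eq_bigl => l.
  apply/andb_idr => /nonneg_loweredP [Ll _]; exact: mem_set.
- exact: fset_uniq.
- by move=> l /= /nonneg_loweredP [].
- move=> l Ll /negP nF; apply: f0 => //; apply: contrapT => nneg; apply: nF.
  by apply/nonneg_loweredP; split=> //; apply/negP.
Qed.

Lemma fsbig_expansion (K : fieldType) k r (C : multiindex A -> int) :
  (forall l, lowering_of_size r l -> negative_exponent (lowered k l) ->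
    C l = 0) ->
  \sum_(l \in lowering_of_size r) (C l)%:~R *: zmonomial K (lowered k l) =
  \sum_(l <- nonneg_lowered k r) (C l)%:~R *: zmonomial K (lowered k l).
Proof.
move=> C0; apply: fsbig_lowering => l Ll nl.
by rewrite (C0 _ Ll nl) scale0r.
Qed.

Lemma expansion_unique (K : fieldType) k r (C C' : multiindex A -> int) :
  [pchar K] =i pred0 ->
  expansion_coefficients K k r C -> expansion_coefficients K k r C' ->
  forall l, lowering_of_size r l -> C l = C' l.
Proof.
move=> charK0 [C0 EC] [C0' EC'] l Ll.
have [neg|nneg] := boolP (negative_exponent (lowered k l)).
  by rewrite C0 ?C0'.
(* By injectivity, [l] is the only index whose monomial is [lowered_nat k l], so reading off that
   coefficient isolates [B l]. *)
have coef (B : multiindex A -> int) :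
    (forall l, lowering_of_size r l -> negative_exponent (lowered k l) ->
      B l = 0) ->
    (\sum_(l \in lowering_of_size r) (B l)%:~R *: zmonomial K (lowered k l))
      @_(lowered_nat k l) = (B l)%:~R.
  move=> B0; rewrite fsbig_expansion //.
  have lF : l \in nonneg_lowered k r by apply/nonneg_loweredP.
  rewrite (big_fsetD1 _ lF) /= mcoeffD mcoeffZ zmonomialE // mcoeffUU mulr1.
  rewrite raddf_sum big_seq big1 ?addr0 // => m.
  rewrite in_fsetD1 => /andP[ml /nonneg_loweredP [[lowm _] nm]].
  rewrite [LHS]mcoeffZ zmonomialE // mcoeffU1.
  case: eqP => [/lowered_nat_inj E|]; last by rewrite mulr0.
  by move: ml; rewrite E ?eqxx //; case: Ll.
by apply: (intr_inj_pchar0 charK0); rewrite -coef // -EC EC' coef.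
Qed.

End Lowering.

(** * Adding a unit vector to a lowering multi-index, and the recursion *)

Section Raising.
Variable A : finType.
Implicit Types (k l : multiindex A) (i : var_index A).

Definition removable l : pred (var_index A) :=
  fun i => (0 <= val i.2) && (1 <= l i)%N.

Lemma level_up_ge0 (j : level) : 0 <= val (level_up j).
Proof. by rewrite -lerBlDr sub0r (valP j). Qed.

Lemma level_up_eqF (j : level) : (level_up j == j) = false.
Proof. by rewrite -val_eqE /= -subr_eq0 addrAC subrr. Qed.

(** Adding e_i to [l] takes one from the exponent at [i] and, through the left shift, gives one to
    the variable a level below [i]; the last indicator tests whether [x] is that variable. *)
Lemma lowered_mulcm k l i x :
  lowered k (mulcm l (ucm i)) x =
    lowered k l x - (i == x)%:Z + (i == (x.1, level_up x.2))%:Z.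
Proof.
case: x => a j; rewrite !loweredE !left_shiftE !mulcmE !ucmE /=.
by rewrite !PoszD opprD !addrA; congr (_ + _); rewrite -!addrA; congr (_ + _);
  congr (_ + _); rewrite addrC.
Qed.

(** On exponents, this is the replacement of one factor x_j^a by x_(j-1)^a, as in the Leibniz rule;
    [0 < m i] makes the truncated difference exact. *)
Lemma lowered_raise k l (m : multiindex A) i i' :
  (forall x : var_index A, lowered k l x = (m x)%:Z) -> (0 < m i)%N ->
  i = (i'.1, level_up i'.2) ->
  forall x, lowered k (mulcm l (ucm i)) x =
    (mulcm (divcm m (ucm i)) (ucm i') x)%:Z.
Proof.
move=> lm mi Ei x; rewrite lowered_mulcm lm mulcmE divcmE.
rewrite [X in (_ - X)%N]ucmE [X in (_ + X)%N]ucmE.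
(* Both indicators agree because [level_up] is injective. *)
have <- : (i == (x.1, level_up x.2)) = (i' == x).
  rewrite Ei; case: x i' {Ei} => b g [c h]; rewrite !xpair_eqE.
  by congr (_ && _); rewrite /= -level_up_down level_down_up.
rewrite PoszD; congr (_ + _).
by case: eqP => [<-|_]; rewrite ?subn0 ?subr0 // subzn.
Qed.

Lemma divcmK l i : (1 <= l i)%N -> mulcm (divcm l (ucm i)) (ucm i) = l.
Proof.
move=> li; apply/eqP/cmP => x; rewrite mulcmE divcmE ucmE.
by case: eqVneq => [<-|_]; rewrite ?subnK // subn0 addn0.
Qed.

Lemma mulcmK l i : divcm (mulcm l (ucm i)) (ucm i) = l.
Proof. by apply/eqP/cmP => x; rewrite divcmE mulcmE addnK. Qed.

(** At a level at least 0, a unit vector leaves the coordinates at level -1 alone and adds 1 to the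
    degree. *)
Lemma lowering_mulcm r l i : 0 <= val i.2 ->
  lowering_of_size r.+1 (mulcm l (ucm i)) <-> lowering_of_size r l.
Proof.
move=> i0; rewrite /lowering_of_size /= -addn1 -(mdegU i).
rewrite -[mdeg (mulcm _ _)]/(mdeg (mmul l (ucm i))) mdegM.
have low0 a : ucm i (a, level_bot) = 0%N.
  rewrite ucmE; case: eqP => // Ei; by rewrite Ei in i0.
split=> -[lowl /eqP degl]; split.
- by move=> a; have := lowl a; rewrite mulcmE low0 addn0.
- by apply/eqP; rewrite -(eqn_add2r (mdeg (ucm i))).
- by move=> a; rewrite mulcmE low0 addn0.
- by apply/eqP; rewrite eqn_add2r.
Qed.

(** The change of index l' = l + e_i by which terms are collected. *)
Lemma removable_bij r i : 0 <= val i.2 ->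
  set_bij (lowering_of_size r.+1 `&` [set l | (1 <= l i)%N])
    (lowering_of_size r) (fun l => divcm l (ucm i)).
Proof.
move=> i0; split.
- by move=> l [Ll li]; apply/(lowering_mulcm _ _ i0); rewrite divcmK.
- move=> l l' /set_mem [_ li] /set_mem [_ li'] eql.
  by rewrite -(divcmK li) eql divcmK.
- move=> l Ll; exists (mulcm l (ucm i)); last exact: mulcmK.
  split; first by apply/lowering_mulcm.
  by rewrite /= mulcmE ucmE eqxx addn1.
Qed.

(** The recursion as differentiation produces it: the factor is the exponent of the differentiated
    variable in the monomial attached to l - e_i. *)
Definition step_coefficient k (C : multiindex A -> int) l : int :=
  \sum_(i \in [set` removable l])
    C (divcm l (ucm i)) * lowered k (divcm l (ucm i)) i.

Lemma step_coefficientE k C l :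
  step_coefficient k C l =
    \sum_(a : A)
      \sum_(j \in [set j : level | 0 <= val j /\ (1 <= l (a, j))%N])
        C (divcm l (ucm (a, j))) *
        ((k (a, j))%:Z - (l (a, j))%:Z + 1 + (l (a, level_up j))%:Z).
Proof.
(* A finite list of all levels occurring in [l]; it turns both sides into finite sums over pairs. *)
pose J := undup [seq i.2 | i <- finsupp l].
have inJ a j : (1 <= l (a, j))%N -> j \in J.
  rewrite lt0n -mem_finsupp => h; rewrite mem_undup.
  by apply/mapP; exists (a, j).
rewrite /step_coefficient -(@bigfs _ _ _ _ [seq (a, j) | a <- enum A, j <- J]).
- rewrite big_mkcond big_allpairs_dep /= big_enum /=; apply: eq_bigr => a _.
  rewrite -big_mkcond (@bigfs _ _ _ _ J); first last.
  + by move=> j /andP[_ /inJ ->].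
  + exact: undup_uniq.
  have -> : [set j : level | 0 <= val j /\ (1 <= l (a, j))%N] =
      [set` fun j => removable l (a, j)].
    by apply/seteqP; split=> j /= => [[? ?]|/andP[]] //; apply/andP.
  apply: eq_fsbigr => j /set_mem /andP[_ lj]; congr (_ * _).
  (* The term +1 appears because l - e_j has coordinate l_j - 1 at level j, while level j + 1 is
     unaffected. *)
  rewrite -{2 3}(divcmK lj) loweredE left_shiftE !mulcmE !ucmE eqxx.
  rewrite xpair_eqE [j == _]eq_sym level_up_eqF andbF addn0 /=.
  by rewrite PoszD opprD; ring.
- rewrite allpairs_uniq ?enum_uniq ?undup_uniq //.
  by move=> [? ?] [? ?].
- move=> [a j] /andP[_ /inJ jJ] /allpairsP[]; exists (a, j).
  by rewrite mem_enum.
Qed.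

Lemma step_coefficient_neg k r (C : multiindex A -> int) l :
  (forall l, lowering_of_size r l -> negative_exponent (lowered k l) ->
    C l = 0) ->
  lowering_of_size r.+1 l -> negative_exponent (lowered k l) ->
  step_coefficient k C l = 0.
Proof.
move=> C0 Ll /negative_exponentP [x zx]; apply: fsbig1 => i /andP[i0 li].
have Ld : lowering_of_size r (divcm l (ucm i)).
  by apply/(lowering_mulcm _ _ i0); rewrite divcmK.
have [neg|/lowered_natE nneg] :=
  boolP (negative_exponent (lowered k (divcm l (ucm i)))).
  by rewrite C0 ?mul0r.
move: zx; rewrite -{1}(divcmK li) lowered_mulcm !nneg.
(* Adding e_i decreases only coordinate [i], so the negative component sits there; the exponent
   before was then 0, and it is a factor of the term. *)
case: (eqVneq i x) => [->|_]; last by rewrite subr0; lia.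
case: (lowered_nat _ _ x) => [|n]; first by rewrite mulr0.
by lia.
Qed.

Variable K : fieldType.

(** The value 0 at level -1 reflects that the derivation kills x_(-1)^a. *)
Definition raised k l i : polyalg K A :=
  if 0 <= val i.2 then zmonomial K (lowered k (mulcm l (ucm i))) else 0.

(** Leibniz rule on a monomial. [D] may be larger than the support, so that one [D] serves all
    monomials of an expansion. *)
Lemma dbar_zmonomial k l (D : {fset var_index A}) :
  ~~ negative_exponent (lowered k l) ->
  (finsupp (lowered_nat k l) `<=` D)%fset ->
  dbar (zmonomial K (lowered k l)) =
    \sum_(i <- D) (lowered k l i)%:~R *: raised k l i.
Proof.
move=> nneg sD; rewrite zmonomialE // dbar_basisE (dbar_basisEw _ sD).
apply: eq_bigr => i _; rewrite (lowered_natE nneg).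
rewrite -[(Posz _)%:~R]/((lowered_nat k l i)%:R).
(* A variable with exponent 0 contributes 0 on both sides, so the shapes need comparing only for
   positive exponents. *)
have [->|mi] := posnP (lowered_nat k l i); first by rewrite !scale0r.
congr (_ *: _); rewrite /raised; case: i mi => a j mi.
have [[Ej _]|[h Ej _]] := level_downP j.
  by rewrite Ej /= /dbar_var level_down_bot mulr0.
rewrite Ej in mi *.
rewrite level_up_ge0 /dbar_var /= level_down_up /var -basisM.
have shape := @lowered_raise _ _ _ _ (a, h) (lowered_natE nneg) mi erefl.
have nneg' : ~~ negative_exponent (lowered k (mulcm l (ucm (a, level_up h)))).
  by apply/negative_exponentP => -[x]; rewrite shape.
rewrite (zmonomialE _ nneg'); congr (<< _ >>); apply/eqP/cmP => x.
by have := lowered_natE nneg' x; rewrite shape => -[].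
Qed.

Lemma expansion_step k r (C : multiindex A -> int) :
  expansion_coefficients K k r C ->
  expansion_coefficients K k r.+1 (step_coefficient k C).
Proof.
move=> [C0 EC]; split=> [l|]; first exact: step_coefficient_neg.
pose D := (\bigcup_(l <- nonneg_lowered k r) finsupp (lowered_nat k l))%fset.
have sD l : l \in nonneg_lowered k r -> (finsupp (lowered_nat k l) `<=` D)%fset.
  by move=> lF; apply: bigfcup_sup.
(* [G i l] is the contribution of variable [i] to the derivative of the term at [l]; [H] records the
   same contribution at the index l + e_i. *)
pose G i l := (C l * lowered k l i)%:~R *: raised k l i.
pose H i l := if removable l i then G i (divcm l (ucm i)) else 0.
(* Differentiate term by term and bring the variables outside, so that each can be reindexed
   separately. *)
transitivity (\sum_(i <- D) \sum_(l \in lowering_of_size r) G i l).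
  have -> : iter r.+1 (@dbar K A) (monomial K k) =
      dbar (iter r (@dbar K A) (monomial K k)) by exact: iterS.
  rewrite (etrans EC (fsbig_expansion K C0)) linear_sum.
  transitivity (\sum_(l <- nonneg_lowered k r) \sum_(i <- D) G i l).
    apply: eq_big_seq => l lF; have [Ll nl] := (nonneg_loweredP _ _ _).1 lF.
    rewrite linearZ /= (dbar_zmonomial nl (sD _ lF)) scaler_sumr.
    by apply: eq_bigr => i _; rewrite scalerA -rmorphM.
  rewrite exchange_big; apply: eq_bigr => i _; apply/esym/fsbig_lowering.
  by move=> l Ll nl; rewrite /G (C0 _ Ll nl) mul0r scale0r.
(* For fixed [i] at level at least 0, substitute l + e_i for l; at level -1 both inner sums
   vanish. *)
transitivity (\sum_(i <- D) \sum_(l \in lowering_of_size r.+1) H i l).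
  apply: eq_bigr => i _; have [i0|i0] := boolP (0 <= val i.2); last first.
    rewrite !fsbig1 // => l _; first by rewrite /H /removable (negbTE i0).
    by rewrite /G /raised (negbTE i0) scaler0.
  rewrite (reindex_fsbig _ _ _ _ (removable_bij r i0)) fsbig_mkcondr.
  apply: eq_fsbigr => l _; rewrite /H /removable i0 /=.
  by rewrite mem_setE.
have stepC0 l := @step_coefficient_neg k r C l C0.
apply: etrans (esym (fsbig_expansion K stepC0)).
transitivity (\sum_(i <- D) \sum_(l <- nonneg_lowered k r.+1) H i l).
  apply: eq_bigr => i _; apply: fsbig_lowering => l Ll nl.
  rewrite /H; case: ifP => // /andP[i0 li].
  by rewrite /G /raised i0 divcmK // /zmonomial nl scaler0.
rewrite exchange_big; apply: eq_big_seq => l lF.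
have [Ll nl] := (nonneg_loweredP _ _ _).1 lF.
(* A removable [i] outside [D] adds nothing to the recursion: either [C] vanishes at l - e_i, or the
   exponent at [i] is 0. *)
rewrite /step_coefficient -(@bigfs _ _ _ _ D) ?fset_uniq //; last first.
  move=> i /andP[i0 li] iD.
  have Ld : lowering_of_size r (divcm l (ucm i)).
    by apply/(lowering_mulcm _ _ i0); rewrite divcmK.
  have [neg|nd] := boolP (negative_exponent (lowered k (divcm l (ucm i)))).
    by rewrite C0 ?mul0r.
  have dF : divcm l (ucm i) \in nonneg_lowered k r by apply/nonneg_loweredP.
  rewrite lowered_natE // fsfun_dflt ?mulr0 //.
  by apply: contra iD; apply/fsubsetP/sD.
rewrite rmorph_sum scaler_suml [RHS]big_mkcond; apply: eq_bigr => i _.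
rewrite /H /=; case rm: (removable l i); last reflexivity.
have /andP[i0 li] := rm.
by rewrite /G /raised i0 (divcmK li).
Qed.

Lemma expansion0 k : expansion_coefficients K k 0 (fun=> 1).
Proof.
have L0 l : lowering_of_size 0 l -> l = mone by case=> _ /mdeg_eq0I.
have z0 x : lowered k mone x = (k x)%:Z.
  by case: x => a j; rewrite loweredE left_shiftE !onecmE subr0 addr0.
have nneg : ~~ negative_exponent (lowered k mone).
  by apply/negative_exponentP => -[x]; rewrite z0.
split=> [l /L0 ->|]; first by rewrite (negbTE nneg).
have -> : lowering_of_size 0 = [set mone] :> set (multiindex A).
  apply/seteqP; split=> l /=; first exact: L0.
  by move=> ->; split; [move=> a; exact: onecmE | exact: mdeg1].
rewrite fsbig_set1 scale1r zmonomialE // [LHS]monomialE; congr (<< _ >>).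
by apply/eqP/cmP => x; have := lowered_natE nneg x; rewrite z0 => -[].
Qed.

End Raising.

Theorem proposition5p3 (K : fieldType) (charK0 : [pchar K] =i pred0)
    (A : finType) (k : multiindex A) :
  (forall r : nat, exists C : multiindex A -> int,
     expansion_coefficients K k r C /\
     forall C' : multiindex A -> int, expansion_coefficients K k r C' ->
       forall l, lowering_of_size r l -> C' l = C l)
  /\
  (forall C : multiindex A -> int,
     (forall r : nat, expansion_coefficients K k r C) ->
     C mone = 1 /\
     forall l : multiindex A, is_lowering l -> l <> mone ->
       C l = \sum_(a : A)
               \sum_(j \in [set j : level | 0 <= val j /\ (1 <= l (a, j))%N])
                 C (divcm l (ucm (a, j))) *
                 ((k (a, j))%:Z - (l (a, j))%:Z + 1 + (l (a, level_up j))%:Z)).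
Proof.
split=> [r|C EC].
  have [C EC] : exists C, expansion_coefficients K k r C.
    elim: r => [|r [C EC]]; first by exists (fun=> 1); exact: expansion0.
    by exists (step_coefficient k C); exact: expansion_step.
  exists C; split=> [|C' EC']; first exact: EC.
  exact: (expansion_unique charK0 EC' EC).
split.
  (* The constant family 1 expands order 0, so uniqueness gives the value at [mone]. *)
  apply: (expansion_unique charK0 (EC 0%N) (expansion0 K k)).
  by split=> [a|]; [exact: onecmE | exact: mdeg1].
move=> l lowl l1; rewrite -step_coefficientE.
case El: (mdeg l) => [|r]; first by case: l1; exact: mdeg_eq0I.
(* [C] and [step_coefficient k C] both expand order r + 1, so uniqueness turns the construction into
   a recursion satisfied by [C] itself. *)
exact: (expansion_unique charK0 (EC r.+1) (expansion_step (EC r))).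
Qed.
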